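(* If $c_1,\ldots,c_k$ are positive integers for some $k\ge 1$, then there is a vertex-transitive map $\mathcal M$, on a compact orientable surface without boundary, such that the reflections of $\mathcal M$ form exactly $k$ conjugacy classes in ${\rm Aut}\,\mathcal M$, of sizes $c_1,\ldots,c_k$.
   Context: All maps (graphs embedded in surfaces; loops and multiple edges allowed) are connected. They are described algebraically as follows. Let $\Gamma=\langle R_0,R_1,R_2\mid R_0^2=R_1^2=R_2^2=(R_0R_2)^2=1\rangle$. A map $\mathcal M$ corresponds to a transitive (right) action of $\Gamma$ on a non-empty set $\Phi$, the set of flags (mutually incident vertex-edge-face triples) of $\mathcal M$, where $R_i$ sends each flag $\phi$ to the other flag sharing the same $j$-dimensional components for all $j\neq i$ if there is one, and fixes $\phi$ otherwise; every transitive $\Gamma$-set arises in this way. The vertices, edges and faces of $\mathcal M$ are the orbits on $\Phi$ of $\langle R_1,R_2\rangle$, $\langle R_0,R_2\rangle$ and $\langle R_0,R_1\rangle$ respectively, with incidence given by non-empty intersection. The map subgroups of $\mathcal M$ are the stabilisers $M\le\Gamma$ of flags (a conjugacy class of subgroups). The underlying surface is compact if and only if $\Phi$ is finite; it is orientable and without boundary if and only if $M\le\Gamma^+$, the index-$2$ subgroup of $\Gamma$ consisting of the words of even length in $R_0,R_1,R_2$. The automorphism group ${\rm Aut}\,\mathcal M$ is the group of permutations of $\Phi$ commuting with the action of $\Gamma$ (it is isomorphic to $N_\Gamma(M)/M$). The map $\mathcal M$ is vertex-transitive if ${\rm Aut}\,\mathcal M$ acts transitively on its vertices. A reflection of $\mathcal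 M$ is an automorphism (necessarily of order $2$) which fixes a point of the surface and acts as a reflection on a disc-shaped neighbourhood of that point; algebraically, it is an automorphism $r\ne 1$ such that $r(\phi)=\phi R_i$ for some flag $\phi\in\Phi$ and some $i\in\{0,1,2\}$ (equivalently, a non-identity automorphism induced by a conjugate of some $R_i$ lying in $N_\Gamma(M)$). *)

(* Defs.v *)
From mathcomp Require Import all_boot all_fingroup.

Set Implicit Arguments.
Unset Strict Implicit.
Unset Printing Implicit Defensive.

Import GroupScope.

(* A map on a compact surface is a transitive right action of
   Gamma = <R_0, R_1, R_2 | R_0^2 = R_1^2 = R_2^2 = (R_0 R_2)^2 = 1>
   on its set of flags, which is finite exactly when the surface is compact.
   The action is given by the images of the three generators; [ord0] and
   [ord_max] are 0 and 2 in ['I_3].  Permutations compose from left to right in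
   MathComp, as befits a right action, and [transitive] on a set entails that
   the set is non-empty. *)
Record compact_map := CompactMap {
  flag : finType;
  R : 'I_3 -> {perm flag};
  R_invol : forall i, R i ^+ 2 = 1;
  R02_invol : (R ord0 * R ord_max) ^+ 2 = 1;
  R_trans : [transitive <<[set R i | i : 'I_3]>>, on [set: flag] | 'P]
}.

Definition monodromy (M : compact_map) : {group {perm flag M}} := <<[set R M i | i : 'I_3]>>%G.

(* The i-dimensional cells: vertices, edges and faces for i = 0, 1, 2. *)
Definition cells (M : compact_map) (i : 'I_3) : {set {set flag M}} :=
  orbit 'P <<[set R M j | j : 'I_3 & j != i]>> @: [set: flag M].

Definition vertices (M : compact_map) := cells M ord0.

(* The flag stabilisers lie in Gamma^+: elements of Gamma are represented by
   words in the generators, whose length has a well-defined parity since all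
   the relators of Gamma have even length. *)
Definition orientable_without_boundary (M : compact_map) : Prop :=
  forall (phi : flag M) (w : seq 'I_3),
    (\prod_(i <- w) R M i) phi = phi -> ~~ odd (size w).

Definition map_aut (M : compact_map) : {group {perm flag M}} := 'C(monodromy M)%G.

Definition vertex_transitive (M : compact_map) : bool :=
  [transitive map_aut M, on vertices M | 'P^*].

Definition reflections (M : compact_map) : {set {perm flag M}} :=
  [set r in map_aut M |
    (r != 1) && [exists phi : flag M, exists i : 'I_3, r phi == R M i phi]].

Definition reflection_classes (M : compact_map) : {set {set {perm flag M}}} :=
  [set r ^: map_aut M | r in reflections M].

(* Main.v *)
Require Import Defs.
From mathcomp Require Import all_boot all_fingroup.

(** A finite group [G] generated by involutions is made into the automorphism
group of a map, as in a Cayley map: the vertices are the elements of [G], and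
around each vertex the same finite set of darts is laid out in the same cyclic
order.  A dart [j] carries a voltage [v j] in [G] and has a mate; following it
from the vertex [g] leads to the vertex [g * v j] along the mate of [j].  The
flags are the triples (vertex, dart, side of the dart), and left translation
by [G] permutes them freely while being transitive on vertices.

Suppose that [G] has a parity, that is, a homomorphism to [Z/2].  Let an edge
whose voltage is odd be glued so that the side is kept, and an edge whose
voltage is even so that the side is changed.  Then parity of [g] plus side is
changed by every [R_i], whence the surface is orientable without boundary.
A left translation sends a flag [phi] to [phi R_i] only across an edge whose
dart is its own mate and has odd voltage [s], and it is then translation by a
conjugate of [s].  So if left translations are the only automorphisms, the
reflections correspond to the conjugates in [G] of the odd generators.

There are no further automorphisms because of a few darts that break the
symmetry around a vertex: two loops, placed so that one flag at each vertex is
distinguished by a property stated in terms of the [R_i] alone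
([markedP], [map_autE]).  Automorphisms being determined by the image of one
flag, each one is a left translation.

It remains to find [G].  Take a set of points cut into [k] blocks of sizes
[c_1, ..., c_k], and double every point.  Inside the symmetric group of the
doubled points let [G] be generated by the flips (the transposition of the two
copies of a point) and the swaps (the exchange of two points of one block, with
their copies).  A flip is a transposition and a swap is a product of two, so
the sign of a permutation is the desired parity.  Conjugation in [G] takes the
flip of a point to the flip of any point of its block and to nothing else
([flip_class]), so the odd generators lie in [k] classes, of sizes
[c_1, ..., c_k]. *)

(** * Automorphisms as elements of a centralizer *)

Section Centralizers.
Import GroupScope.
Set Implicit Arguments.
Unset Strict Implicit.

(** The semiregularity of the centralizer of a transitive group: an automorphism
of a map is determined by the image of one flag. *)
Lemma cent_trans_eq (T : finType) (K : {group {perm T}}) (a b : {perm T}) x :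
  [transitive K, on [set: T] | 'P] -> a \in 'C(K) -> b \in 'C(K) ->
  a x = b x -> a = b.
Proof.
move=> trK cKa cKb abx; apply/permP => y.
have [p Kp ->] := atransP2 trK (in_setT x) (in_setT y).
by rewrite /= /aperm -!permM -(centP cKa _ Kp) -(centP cKb _ Kp) !permM abx.
Qed.

Lemma setact_orbit_cent (T : finType) (K : {group {perm T}}) (a : {perm T}) x :
  a \in 'C(K) -> 'P^*%act (orbit 'P K x) a = orbit 'P K (a x).
Proof.
move=> cKa; rewrite [LHS]/= /setact /orbit -imset_comp.
apply: eq_in_imset => p Kp /=.
by rewrite /aperm -!permM (centP cKa _ Kp).
Qed.

End Centralizers.

(** * Maps from groups generated by involutions *)

Section CayleyMap.
Import GroupScope.
Set Implicit Arguments.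
Unset Strict Implicit.

Variables (gT : finGroupType) (odd_elt : gT -> bool) (s0 : gT) (w : seq gT).
Hypothesis odd_eltM : {morph odd_elt : x y / x * y >-> x (+) y}.
Hypothesis s0w_neq1 : forall s, s \in s0 :: w -> s != 1.
Hypothesis s0w_invol : forall s, s \in s0 :: w -> s * s = 1.
Hypothesis s0w_gen : <<[set s in s0 :: w]>> = [set: gT].

(** The generators are listed as [s0 :: w], and [s0] is also used once more, on
dart 3.  The darts at a vertex are, in cyclic order, 0 and 1 (the two ends of
one loop), 2 and 4 (the two ends of another), 3 between them, and then one dart
for each generator. *)
Definition darts := 'I_(size w + 5).+1.

Definition voltage_seq : seq gT := [:: 1, 1, 1, s0, 1, s0 & w].

Definition voltage (j : darts) : gT := nth 1 voltage_seq j.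

Definition mate_nat n :=
  match n with 0 => 1 | 1 => 0 | 2 => 4 | 4 => 2 | _ => n end%N.

Lemma mate_subproof (j : darts) : (mate_nat j < (size w + 5).+1)%N.
Proof. by case: j => [[|[|[|[|[|j]]]]] lt_j] /=; rewrite ?lt_j ?addnS. Qed.

Definition mate (j : darts) : darts := Ordinal (mate_subproof j).

Lemma mateK : involutive mate.
Proof. by case=> [[|[|[|[|[|j]]]]] /= lt_j]; apply: val_inj. Qed.

Lemma odd_elt1 : odd_elt 1 = false.
Proof. by have := odd_eltM 1 1; rewrite mulg1; case: (odd_elt 1). Qed.

Lemma voltage_fixed_dart j : mate j = j -> voltage j \in s0 :: w.
Proof.
case: j => [[|[|[|[|[|j]]]]] lt_j] /(congr1 val) //= _; rewrite /voltage /=.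
  exact: mem_head.
by rewrite mem_nth //=; move: lt_j; rewrite !addnS addn0 !ltnS.
Qed.

Lemma voltage_loop j : mate j != j -> voltage j = 1.
Proof. by case: j => [[|[|[|[|[|j]]]]] lt_j] //; rewrite -val_eqE /= eqxx. Qed.

Lemma mate_moves_mate j : (mate (mate j) != mate j) = (mate j != j).
Proof. by rewrite mateK eq_sym. Qed.

Lemma voltage_mate j : voltage j * voltage (mate j) = 1.
Proof.
have [fix_j | mv_j] := eqVneq (mate j) j.
  by rewrite fix_j s0w_invol ?voltage_fixed_dart.
by rewrite !voltage_loop ?mate_moves_mate ?mulg1.
Qed.

Lemma odd_voltage_mate j : odd_elt (voltage (mate j)) = odd_elt (voltage j).
Proof.
have := odd_eltM (voltage j) (voltage (mate j)).
by rewrite voltage_mate odd_elt1; do 2!case: (odd_elt _).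
Qed.

Lemma generator_voltage s : s \in s0 :: w ->
  exists2 j, mate j = j & voltage j = s.
Proof.
move=> sw; have lt_j : ((index s (s0 :: w)).+4.+1 < (size w + 5).+1)%N.
  by move: sw; rewrite -index_mem /= !addnS addn0.
exists (Ordinal lt_j); first exact: val_inj.
by rewrite /voltage /= -[RHS](nth_index 1 sw).
Qed.

(** A flag is a vertex, a dart at it and a side of that dart, [true] being the
side towards the next dart in the cyclic order. *)
Definition cflag : finType := (gT * darts * bool)%type.

(** The side changes exactly when the voltage is even: this makes [flag_parity]
change under [R_0] whatever the dart. *)
Definition R0_fun (x : cflag) : cflag :=
  (x.1.1 * voltage x.1.2, mate x.1.2, x.2 (+) ~~ odd_elt (voltage x.1.2)).
Definition R1_fun (x : cflag) : cflag :=
  (x.1.1, if x.2 then ordS x.1.2 else ord_pred x.1.2, ~~ x.2).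
Definition R2_fun (x : cflag) : cflag := (x.1.1, x.1.2, ~~ x.2).

Lemma R0_funK : involutive R0_fun.
Proof.
case=> [[g j] e]; rewrite /R0_fun /= -mulgA voltage_mate mulg1 mateK.
by rewrite odd_voltage_mate -addbA addbb addbF.
Qed.

Lemma R1_funK : involutive R1_fun.
Proof. by case=> [[g j] [|]]; rewrite /R1_fun /= ?ordSK ?ord_predK. Qed.

Lemma R2_funK : involutive R2_fun.
Proof. by case=> [[g j] e]; rewrite /R2_fun /= negbK. Qed.

Definition cayley_R (i : 'I_3) : {perm cflag} :=
  match val i with
  | 0 => perm (inv_inj R0_funK)
  | 1 => perm (inv_inj R1_funK)
  | _ => perm (inv_inj R2_funK)
  end%N.

Let i0 : 'I_3 := ord0.
Let i1 : 'I_3 := Ordinal (isT : 1 < 3)%N.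
Let i2 : 'I_3 := ord_max.

Lemma R0E x : cayley_R i0 x = R0_fun x. Proof. by rewrite permE. Qed.
Lemma R1E x : cayley_R i1 x = R1_fun x. Proof. by rewrite permE. Qed.
Lemma R2E x : cayley_R i2 x = R2_fun x. Proof. by rewrite permE. Qed.

Lemma I3_ind3 (P : 'I_3 -> Prop) : P i0 -> P i1 -> P i2 -> forall i, P i.
Proof.
move=> P0 P1 P2 [[|[|[|//]]] lt_i]; [move: P0|move: P1|move: P2];
  by congr P; apply: val_inj.
Qed.

Lemma cayley_R_invol i : cayley_R i ^+ 2 = 1.
Proof.
elim/I3_ind3: i; apply/permP => x; rewrite expgS expg1 permM perm1.
- by rewrite !R0E R0_funK.
- by rewrite !R1E R1_funK.
- by rewrite !R2E R2_funK.
Qed.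

Lemma cayley_R02_invol : (cayley_R i0 * cayley_R i2) ^+ 2 = 1.
Proof.
apply/permP => -[[g j] e]; rewrite expgS expg1 !permM perm1 !(R0E, R2E).
rewrite /R0_fun /R2_fun /= -mulgA voltage_mate mulg1 mateK odd_voltage_mate.
by case: e (odd_elt _) => [] [].
Qed.

Let mon : {group {perm cflag}} := <<[set cayley_R i | i : 'I_3]>>%G.

Lemma cayley_R_mon i : cayley_R i \in mon.
Proof. exact/mem_gen/imset_f. Qed.

Let vertex_mon : {group {perm cflag}} :=
  <<[set cayley_R j | j : 'I_3 & j != ord0]>>%G.

Lemma vertex_mon_sub : vertex_mon \subset mon.
Proof.
by apply: genS; apply/subsetP => _ /imsetP[i _ ->]; apply: imset_f.
Qed.

Lemma vertex_monR i x : i != ord0 -> cayley_R i x \in orbit 'P vertex_mon x.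
Proof.
by move=> i_n0; apply/orbitP; exists (cayley_R i);
  rewrite // mem_gen ?imset_f ?inE.
Qed.

Lemma vertex_orbit (g : gT) (j : darts) e :
  (g, j, e) \in orbit 'P vertex_mon (g, ord0, true).
Proof.
have flip k b c : (g, k, b) \in orbit 'P vertex_mon (g, ord0, true) ->
    (g, k, c) \in orbit 'P vertex_mon (g, ord0, true).
  have [-> //|neq_bc] := eqVneq b c; apply: orbit_trans.
  have -> : (g, k, c) = cayley_R i2 (g, k, b).
    by rewrite R2E; case: b c neq_bc => [] [].
  exact: vertex_monR.
apply: (flip _ true); case: j => n; elim: n => [|n IHn] lt_n.
  by rewrite (_ : Ordinal _ = ord0) ?orbit_refl //; apply: val_inj.
apply: (flip _ false); have lt_n' := ltnW lt_n.
apply: orbit_trans (IHn lt_n').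
have -> : (g, Ordinal lt_n, false) = cayley_R i1 (g, Ordinal lt_n', true).
  rewrite R1E; congr (_, _, _); apply: val_inj => /=.
  by rewrite modn_small.
exact: vertex_monR.
Qed.

(** Connectedness, where it is used that the generators generate: the group
elements [h] by which one can always move from any vertex [g] to [g * h] form a
subgroup, which contains every voltage. *)
Lemma identity_vertex_reaches (g : gT) :
  (g, ord0, true) \in orbit 'P mon (1, ord0, true : bool).
Proof.
(* Quantifying over all [g] makes [H] closed under products. *)
pose H := [set h | [forall g : gT,
  (g * h, ord0, true) \in orbit 'P mon (g, ord0 : darts, true : bool)]].
have groupH : group_set H.
  apply/group_setP; split=> [|x y]; rewrite ?inE.
    by apply/forallP => x; rewrite mulg1 orbit_refl.
  move=> /forallP Hx /forallP Hy; apply/forallP => z.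
  by rewrite mulgA; apply: orbit_trans (Hx z).
have vm x y : x \in orbit 'P vertex_mon y -> x \in orbit 'P mon y.
  by apply/subsetP; apply: imsetS; apply: vertex_mon_sub.
suffices: g \in Group groupH by rewrite inE => /forallP/(_ 1); rewrite mul1g.
suffices: <<[set s in s0 :: w]>> \subset Group groupH.
  by rewrite s0w_gen => /subsetP; apply; rewrite inE.
rewrite gen_subG; apply/subsetP => s.
rewrite inE => /generator_voltage[j fix_j vj].
rewrite inE; apply/forallP => x.
have [e xse] : exists e, cayley_R i0 (x, j, true) = (x * s, j, e).
  by rewrite R0E /R0_fun /= fix_j vj; eexists.
apply: (@orbit_trans _ _ _ _ _ (x * s, j, e)).
  by rewrite orbit_sym; apply/vm/vertex_orbit.
apply: (@orbit_trans _ _ _ _ _ (x, j, true)); last exact/vm/vertex_orbit.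
by rewrite -xse (mem_orbit 'P) ?cayley_R_mon.
Qed.

Lemma cayley_trans : [transitive mon, on [set: cflag] | 'P].
Proof.
apply/imsetP; exists (1, ord0, true) => //; apply/esym/setP => -[[g j] e].
rewrite in_setT; apply: orbit_trans (identity_vertex_reaches g).
by apply: (subsetP (imsetS _ vertex_mon_sub)); apply: vertex_orbit.
Qed.

Definition cayley_map : compact_map :=
  CompactMap cayley_R_invol cayley_R02_invol cayley_trans.

(** A 2-colouring of the flags for which each [R_i] changes colours: its
existence is what orientability without boundary means. *)
Definition flag_parity (x : cflag) := odd_elt x.1.1 (+) x.2.

Lemma flag_parityR i x : flag_parity (cayley_R i x) = ~~ flag_parity x.
Proof.
case: x => [[g j] e]; elim/I3_ind3: i.
- rewrite R0E /flag_parity /= odd_eltM.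
  by case: (odd_elt g) (odd_elt (voltage j)) e => [] [] [].
- by rewrite R1E /flag_parity /= addbN.
- by rewrite R2E /flag_parity /= addbN.
Qed.

Lemma cayley_orientable : orientable_without_boundary cayley_map.
Proof.
have parity_word s x :
    flag_parity ((\prod_(i <- s) R cayley_map i) x)
      = odd (size s) (+) flag_parity x.
  elim: s x => [|i s IHs] x; first by rewrite big_nil perm1.
  by rewrite big_cons permM IHs flag_parityR addbN /= addNb.
move=> phi s fix_phi; have := parity_word s phi.
by rewrite fix_phi; case: (odd _) => //; case: flag_parity.
Qed.

(** The inverse makes [translation] a homomorphism, since permutations compose
from left to right. *)
Lemma translation_fun_inj (h : gT) :
  injective (fun x : cflag => (h^-1 * x.1.1, x.1.2, x.2) : cflag).
Proof. by move=> [[g j] e] [[g' j'] e'] /= [/mulgI-> -> ->]. Qed.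

Definition translation h : {perm cflag} :=
  perm (@translation_fun_inj h).

Lemma translationE h g j e : translation h (g, j, e) = (h^-1 * g, j, e).
Proof. by rewrite permE. Qed.

Lemma translationM :
  {in [set: gT] &, {morph translation : x y / x * y}}.
Proof.
move=> x y _ _; apply/permP => -[[g j] e].
by rewrite permM !translationE invMg mulgA.
Qed.

Canonical translation_morphism := Morphism translationM.

Lemma translation_inj : injective translation.
Proof.
move=> x y /permP/(_ (1, ord0, true)); rewrite !translationE !mulg1.
by case=> /invg_inj.
Qed.

Lemma translation_aut h : translation h \in map_aut cayley_map.
Proof.
rewrite /map_aut /= cent_gen; apply/centP => _ /imsetP[i _ ->].
apply/permP => -[[g j] e]; rewrite !permM translationE /=.
elim/I3_ind3: i.
- by rewrite !R0E /R0_fun translationE /= mulgA.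
- by rewrite !R1E /R1_fun translationE.
- by rewrite !R2E /R2_fun translationE.
Qed.

(** The first condition says that the edge of [x] bounds a face with one side,
on the side of [x]; only the loop with adjacent ends 0 and 1 does.  That leaves
two flags at a vertex, mirror images of each other, which the second condition
tells apart: [y] is two darts further on, seen in the direction given by [x],
and there a loop is required that returns to the vertex two darts after [y].
From dart 0 this finds the loop with ends 2 and 4; from dart 1, in the reverse
direction, it meets the last dart, which is not a loop. *)
Definition marked (x : cflag) :=
  let R0 := cayley_R i0 in let R1 := cayley_R i1 in let R2 := cayley_R i2 in
  let y := R2 (R1 (R2 (R1 x))) in
  (R0 x == R1 x) && (R0 y == R1 (R2 (R1 y))).

Lemma marked_aut a x : a \in map_aut cayley_map -> marked (a x) = marked x.
Proof.
move=> Aa; have aR i y : cayley_R i (a y) = a (cayley_R i y).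
  by rewrite -!permM (centP Aa) // cayley_R_mon.
by rewrite /marked !aR !(inj_eq perm_inj).
Qed.

Lemma marked_base : marked (1, ord0, true).
Proof.
rewrite /marked !(R0E, R1E, R2E) /R0_fun /R1_fun /R2_fun /= /voltage /=.
by rewrite !modn_small ?addnS //= mulg1 odd_elt1; apply/andP; split; apply/eqP;
  congr (_, _, _); apply: val_inj; rewrite /= ?modn_small ?addnS.
Qed.

(** Only dart 0 is followed by its mate.  The last dart has to be looked at
separately because its successor is 0; it is its own mate as its index is at
least 5. *)
Lemma mate_ordS j : mate j = ordS j -> j = ord0.
Proof.
case: j => n lt_n /(congr1 val) /= mj; apply: val_inj => /=.
move: lt_n mj; rewrite leq_eqVlt ltnS => /predU1P[[->]|lt_n].
  by rewrite modnn !addnS.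
by rewrite modn_small //; case: n lt_n => [|[|[|[|[|n]]]]] // _ /n_Sn.
Qed.

Lemma mate_ord_pred j : mate j = ord_pred j -> j = ordS ord0.
Proof.
move=> mj; rewrite -[j]ord_predK; congr ordS.
by apply: mate_ordS; rewrite -mj mateK mj ord_predK.
Qed.

Lemma voltage_last : voltage (ord_pred ord0) = last s0 w.
Proof.
rewrite /voltage -[RHS](nth_last 1 (s0 :: w)) /= modn_small //.
by rewrite !addnS addn0.
Qed.

Lemma markedP g j e : marked (g, j, e) -> (j, e) = (ord0, true).
Proof.
rewrite /marked !(R0E, R1E, R2E) /R0_fun /R1_fun /R2_fun.
case/andP=> /eqP[_ + _]; case: e => /= [/mate_ordS-> // | /mate_ord_pred->].
rewrite ordSK voltage_last => /eqP[/eqP].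
by rewrite -[X in _ == X]mulg1 (inj_eq (mulgI g)) (negPf (s0w_neq1 _)) ?mem_last.
Qed.

(** An automorphism sends the marked flag at the identity vertex to a marked
flag, which some left translation also reaches. *)
Lemma map_autE : map_aut cayley_map = translation @: [set: gT] :> {set _}.
Proof.
apply/setP => a; apply/idP/imsetP => [Aa | [h _ ->]]; last first.
  exact: translation_aut.
have := marked_base; rewrite -(marked_aut (1, ord0, true) Aa).
case Ea: (a _) => [[g j] e] /markedP[dj de]; exists g^-1 => //.
apply: (cent_trans_eq (x := (1, ord0, true)) cayley_trans Aa).
  exact: translation_aut.
by rewrite Ea translationE invgK mulg1 dj de.
Qed.

Lemma cayley_vertex_transitive : vertex_transitive cayley_map.
Proof.
apply/imsetP; exists (orbit 'P vertex_mon (1, ord0, true : bool)).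
  by apply/imsetP; exists (1, ord0, true).
have cv a : a \in map_aut cayley_map -> a \in 'C(vertex_mon).
  by apply/subsetP; apply: centS; apply: vertex_mon_sub.
apply/setP => V; apply/imsetP/imsetP => [[[[g j] e] _ ->] | [a Aa ->]].
  exists (translation g^-1); first exact: translation_aut.
  rewrite setact_orbit_cent ?cv ?translation_aut //.
  rewrite translationE invgK mulg1.
  exact/orbit_eqP/vertex_orbit.
by exists (a (1, ord0, true)); rewrite // setact_orbit_cent ?cv.
Qed.

Lemma generator_inv s : s \in s0 :: w -> s^-1 = s.
Proof. by move/s0w_invol => ss1; apply: (mulgI s); rewrite mulgV ss1. Qed.

(** A left translation preserves dart and side.  [R_1] and [R_2] change the side
and so does [R_0] when the voltage is even, so only an odd dart that is its own
mate can yield a reflection. *)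
Lemma reflectionsE : reflections cayley_map =
  [set translation (s ^ g) | s in [set s in s0 :: w | odd_elt s],
                             g in [set: gT]].
Proof.
apply/setP => r; rewrite inE map_autE.
apply/and3P/imset2P => [[/imsetP[h _ ->] _] | [s g + _ ->]].
  case/existsP=> -[[g j] e] /existsP[i] /eqP; rewrite translationE /=.
  elim/I3_ind3: i.
  - rewrite R0E /R0_fun => -[hg fix_j] /=.
    rewrite -[LHS]addbF => /addbI/esym/negbFE odd_v.
    have vw := voltage_fixed_dart (esym fix_j).
    exists (voltage j) g^-1; rewrite ?in_setT //; first by rewrite inE vw.
    congr translation; rewrite /conjg invgK -[h]invgK -[h^-1](mulgK g) hg.
    by rewrite !invMg invgK (generator_inv vw).
  - by rewrite R1E; case: e.
  - by rewrite R2E; case: e.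
rewrite inE => /andP[sw odd_s].
split; first exact: imset_f.
  rewrite -(morph1 translation_morphism) (inj_eq translation_inj).
  by rewrite conjg_eq1 s0w_neq1.
have [j fix_j vj] := generator_voltage sw.
apply/existsP; exists (g^-1, j, true); apply/existsP; exists i0.
rewrite translationE [R _ _ _]R0E /R0_fun /= fix_j vj odd_s.
by rewrite conjgE !invMg invgK (generator_inv sw) -!mulgA mulgV mulg1.
Qed.

Lemma reflection_classesE : reflection_classes cayley_map =
  [set translation @: (s ^: [set: gT]) | s in [set s in s0 :: w | odd_elt s]].
Proof.
rewrite /reflection_classes map_autE reflectionsE.
have classE x :
  translation x ^: (translation @: [set: gT]) = translation @: (x ^: [set: gT]).
  have := morphim_class translation_morphism (in_setT x) (subxx _).
  by rewrite !morphimEsub ?subsetT.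
apply/setP => C.
apply/imsetP/imsetP => [[_ /imset2P[s g sw _ ->] ->] | [s sw ->]].
  by exists s; rewrite // classE classGidl ?inE.
exists (translation s); last by rewrite classE.
by apply/imset2P; exists s 1; rewrite ?in_setT ?conjg1.
Qed.

Theorem cayley_map_exists : exists (M : compact_map) (f : gT -> {perm flag M}),
  [/\ injective f, orientable_without_boundary M, vertex_transitive M
    & reflection_classes M =
      [set f @: (s ^: [set: gT]) | s in [set s in s0 :: w | odd_elt s]]].
Proof.
exists cayley_map, translation; split.
- exact: translation_inj.
- exact: cayley_orientable.
- exact: cayley_vertex_transitive.
- exact: reflection_classesE.
Qed.

End CayleyMap.

(** * Signed permutations preserving blocks *)

Section BlockedSignedPermutations.
Import GroupScope.
Set Implicit Arguments.
Unset Strict Implicit.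

Variables (k : nat) (c : 'I_k -> nat).

Local Notation pos := {i : 'I_k & 'I_(c i)}.
Local Notation spt := (pos * bool)%type.

Definition sgn_flip (t : pos) : {perm spt} := tperm (t, false) (t, true).
Definition pos_swap (s t : pos) : {perm spt} :=
  tperm (s, false) (t, false) * tperm (s, true) (t, true).

Definition flips := [seq sgn_flip t | t : pos].
Definition swaps :=
  [seq pos_swap p.1 p.2 | p : pos * pos in
    [pred p | (tag p.1 == tag p.2) && (p.1 != p.2)]].

Lemma sgn_flipE t r b : sgn_flip t (r, b) = (r, (r == t) (+) b).
Proof.
have [->|r_t] := eqVneq; first by case: b; rewrite ?tpermL ?tpermR.
by apply: tpermD; rewrite xpair_eqE eq_sym (negPf r_t).
Qed.

Lemma tperm_layer s t r b0 b :
  tperm (s, b0) (t, b0) (r, b) = (if b == b0 then tperm s t r else r, b) :> spt.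
Proof.
rewrite !permE /= !xpair_eqE; case: (eqVneq b b0) => [-> | _].
  by rewrite !andbT; case: (r == s) => //; case: (r == t).
by rewrite !andbF.
Qed.

Lemma pos_swapE s t r b : pos_swap s t (r, b) = (tperm s t r, b).
Proof. by rewrite permM !tperm_layer; case: b. Qed.

Lemma sgn_flip_inj : injective sgn_flip.
Proof.
move=> s t /permP/(_ (s, false)); rewrite !sgn_flipE eqxx.
by case: eqVneq.
Qed.

Lemma sgn_flip_odd t : sgn_flip t = true :> bool.
Proof. by rewrite odd_tperm xpair_eqE andbF. Qed.

Lemma pos_swap_even s t : pos_swap s t = false :> bool.
Proof. by rewrite odd_permM !odd_tperm !xpair_eqE !andbT addbb. Qed.

Lemma sgn_flip_invol t : sgn_flip t * sgn_flip t = 1.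
Proof. exact: tperm2. Qed.

Lemma pos_swap_invol s t : pos_swap s t * pos_swap s t = 1.
Proof. by apply/permP => -[r b]; rewrite permM !pos_swapE tpermK perm1. Qed.

Lemma sgn_flip_neq1 t : sgn_flip t != 1.
Proof.
by apply/eqP => /(congr1 (@odd_perm _)); rewrite sgn_flip_odd odd_perm1.
Qed.

Lemma pos_swap_neq1 s t : s != t -> pos_swap s t != 1.
Proof.
move=> s_t; apply/eqP => /permP/(_ (s, false)).
by rewrite pos_swapE tpermL perm1 => -[/esym/eqP]; apply/negP.
Qed.

Definition block_group : {group {perm spt}} := <<[set x in flips ++ swaps]>>%G.

(** Every generator permutes the pairs of copies of points within each block,
so the flips of a block form a set normalized by the group; the swaps make the
group transitive on it. *)
Lemma flip_class t :
  sgn_flip t ^: block_group = sgn_flip @: [set s | tag s == tag t].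
Proof.
apply/eqP; rewrite eqEsubset; apply/andP; split.
  rewrite class_sub_norm; first by rewrite imset_f ?inE.
  rewrite gen_subG; apply/subsetP => x; rewrite inE mem_cat inE => x_gen.
  apply/subsetP => _ /imsetP[_ /imsetP[r + ->] ->]; rewrite inE => r_t.
  rewrite /sgn_flip tpermJ; case/orP: x_gen => /imageP[].
    move=> u _ ->; rewrite !sgn_flipE addbF addbT.
    have -> : tperm (r, r == u) (r, ~~ (r == u)) = sgn_flip r.
      by case: (r == u) => //; apply: tpermC.
    by rewrite imset_f ?inE.
  case=> u v; rewrite inE /= => /andP[/eqP uv _] ->; rewrite !pos_swapE.
  apply: (imset_f sgn_flip); rewrite inE.
  by case: (tpermP u v r) => [E|E|//]; move: r_t; rewrite E ?uv.
apply/subsetP => _ /imsetP[s + ->]; rewrite inE => /eqP st.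
have [-> | s_t] := eqVneq s t; first exact: class_refl.
apply/imsetP; exists (pos_swap s t).
  rewrite mem_gen // inE mem_cat; apply/orP; right.
  by apply/imageP; exists (s, t) => //; rewrite inE /= st eqxx.
by rewrite /sgn_flip tpermJ !pos_swapE tpermR.
Qed.

Lemma card_block i : #|[set t : pos | tag t == i]| = c i.
Proof.
have -> : [set t : pos | tag t == i]
    = [set Tagged (fun i => 'I_(c i)) j | j : 'I_(c i)].
  apply/setP => -[l j]; rewrite inE /=.
  apply/eqP/imsetP => [li | [m _ /(congr1 (@tag _ _)) //]].
  by move: j; rewrite li => j; exists j.
by rewrite card_imset ?card_ord //; apply: eq_from_Tagged.
Qed.

Lemma flip_in_group t : sgn_flip t \in block_group.
Proof. by rewrite mem_gen // inE mem_cat image_f. Qed.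

Lemma block_gen_neq1 s : s \in flips ++ swaps -> s != 1.
Proof.
rewrite mem_cat => /orP[] /imageP[] => [t _ | [u v]] /=; last first.
  by rewrite inE => /andP[_ /pos_swap_neq1 uv] ->.
by move->; apply: sgn_flip_neq1.
Qed.

Lemma block_gen_invol s : s \in flips ++ swaps -> s * s = 1.
Proof.
rewrite mem_cat => /orP[] /imageP[] => [t _ | [u v] _] ->.
  exact: sgn_flip_invol.
exact: pos_swap_invol.
Qed.

Lemma odd_block_gen s : (s \in flips ++ swaps) && s = (s \in flips).
Proof.
rewrite mem_cat; apply/andP/idP => [[/orP[// | /imageP[p _ ->]]] | s_flip].
  by rewrite pos_swap_even.
by split; [rewrite s_flip | case/imageP: s_flip => t _ ->; apply: sgn_flip_odd].
Qed.

(** The Cayley map requires a group that is a whole type, hence the passage to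
the subgroup type and back. *)
Lemma block_map_exists (t0 : pos) :
  exists (M : compact_map) (h : pos -> {perm flag M}),
    [/\ injective h, orientable_without_boundary M, vertex_transitive M
      & reflection_classes M =
        [set h @: [set s | tag s == tag t] | t : pos]].
Proof.
pose parity (x : subg_of block_group) : bool := sgval x.
pose s0 := subg block_group (sgn_flip t0).
pose w := [seq subg block_group s | s <- flips ++ swaps].
have gen_sub s : s \in flips ++ swaps -> s \in block_group.
  by move=> s_gen; rewrite mem_gen // inE.
have t0_gen : sgn_flip t0 \in flips ++ swaps by rewrite mem_cat image_f.
have s0w x : (x \in s0 :: w) = (sgval x \in flips ++ swaps).
  rewrite in_cons; apply/idP/idP.
    case/orP=> [/eqP-> | /mapP[s s_gen ->]]; first by rewrite subgK ?gen_sub.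
    by rewrite subgK ?gen_sub.
  move=> x_gen; apply/orP; right; apply/mapP.
  by exists (sgval x); rewrite ?sgvalK.
have parityM : {morph parity : x y / x * y >-> x (+) y}.
  by move=> x y; rewrite /parity morphM ?inE // odd_permM.
have w_neq1 x : x \in s0 :: w -> x != 1.
  rewrite s0w => /block_gen_neq1; apply: contraNneq => ->.
  by rewrite morph1.
have w_invol x : x \in s0 :: w -> x * x = 1.
  rewrite s0w => /block_gen_invol xx; apply: subg_inj.
  by rewrite morphM ?inE // morph1.
have w_gen : <<[set s in s0 :: w]>> = [set: subg_of block_group].
  apply/eqP; rewrite -subTset -im_subg morphim_gen ?subset_gen //.
  apply: genS; apply/subsetP => _ /morphimP[s _ s_gen ->].
  by rewrite inE s0w subgK ?gen_sub //; move: s_gen; rewrite inE.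
have [M [f [inj_f orientable_M vt_M refl_M]]] :=
  cayley_map_exists parityM w_neq1 w_invol w_gen.
exists M, (fun t => f (subg block_group (sgn_flip t))); split=> //.
  move=> s t /inj_f/(congr1 val); rewrite !subgK ?flip_in_group //.
  exact: sgn_flip_inj.
have classE t : f @: (subg block_group (sgn_flip t) ^: setT) =
    [set f (subg block_group (sgn_flip s)) | s in [set s | tag s == tag t]].
  rewrite -[in LHS]im_subg -morphim_class ?flip_in_group // flip_class.
  rewrite morphimEsub -?imset_comp //.
  by apply/subsetP => _ /imsetP[s _ ->]; apply: flip_in_group.
rewrite refl_M; apply/setP => C; apply/imsetP/imsetP => [[x + ->] | [t _ ->]].
  rewrite inE s0w odd_block_gen => /imageP[t _ xt]; exists t => //.
  by rewrite -classE -xt sgvalK.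
exists (subg block_group (sgn_flip t)); last by rewrite classE.
by rewrite inE s0w odd_block_gen subgK ?flip_in_group ?image_f.
Qed.

End BlockedSignedPermutations.

(** * Reflection classes of prescribed sizes *)

Theorem corollary1p2 (k : nat) (c : 'I_k -> nat)
    (hk : 1 <= k) (hc : forall i : 'I_k, 0 < c i) :
  exists M : compact_map,
    [/\ orientable_without_boundary M,
        vertex_transitive M
      & exists C : 'I_k -> {set {perm flag M}},
          [/\ injective C,
              reflection_classes M = [set C i | i : 'I_k]
            & forall i : 'I_k, #|C i| = c i]].
Proof.
pose pt i : {i : 'I_k & 'I_(c i)} := Tagged _ (Ordinal (hc i)).
have [M [h [inj_h orientable_M vt_M refl_M]]] :=
  block_map_exists (pt (Ordinal hk)).
exists M; split=> //; exists (fun i => h @: [set t | tag t == i]); split.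
- move=> i j eqC; have: h (pt i) \in h @: [set t | tag t == i].
    by rewrite imset_f ?inE.
  by rewrite eqC mem_imset // inE => /eqP.
- rewrite refl_M; apply/setP => C; apply/imsetP/imsetP => -[x _ ->].
    by exists (tag x).
  by exists (pt x).
- by move=> i; rewrite card_imset // card_block.
Qed.
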